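(* Let $({\bf A},{\bf G},{\bf P})$ be a probability space and $\mathcal X$ a complete separable metric space. Let $({\bf Z}_{n,k})_{n,k\in\mathbb N}$ and $(V_{k,k'})_{k,k'\in\mathbb N}$ be (real) random variables on $({\bf A},{\bf G})$, let $(f_k)_{k\in\mathbb N}$ be continuous functions on $\mathcal X$, let $K_0=0$, and let $(K_m)_{m\in\mathbb N}$ be a monotonically increasing sequence of positive integers with $K_m\to\infty$ as $m\to\infty$. Assume: 1. For every $m$, $(V_{k,k'})_{1\le k,k'\le K_m}$ is a symmetric nonnegative definite matrix almost surely and $$({\bf Z}_{n,k})_{1\le k\le K_m}\to^{{\bf G}\text{-}\mathcal L}\sqrt{(V_{k,k'})_{1\le k,k'\le K_m}}\,N_m\quad(n\to\infty),$$ where $N_m$ is a $K_m$-dimensional standard normal random variable independent of ${\bf G}$. 2. For every $x\in\mathcal X$ there exists an open set $U_x$ (containing $x$) with the following property: for all $\epsilon>0$, $\delta>0$ there exists a positive integer $M$ such that $${\bf P}\Big[\sup_{x'\in U_x}\Big(\Big|\sum_{k=K_M+1}^{K_{M'}}{\bf Z}_{n,k}f_k(x')\Big|+|\mathcal V_{M'}(x')-\mathcal V_M(x')|\Big)>\delta\Big]<\epsilon$$ for all $M'>M$ and $n\in\mathbb N$, where $\mathcal V_M(x)=\sum_{k,k'=1}^{K_M}V_{k,k'}f_k(x)f_{k'}(x)$. Then ${\bf Z}_n(x):={\bf P}\text{-}\lim_{M\to\infty}\sum_{k=1}^{K_M}{\bf Z}_{n,k}f_k(x)$ exists for every $x\in\mathcal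 X$. Moreover, if $\{{\bf Z}(x)\}_{x\in\mathcal X}$ is a continuous random field on an extension $({\bf A}',{\bf G}')$ of $({\bf A},{\bf G})$ such that ${\bf Z}_n(x)\to^{{\bf G}\text{-}\mathcal L}{\bf Z}(x)$ as $n\to\infty$ for every $x\in\mathcal X$, then $${\bf Z}_n({\bf Y})\to^{{\bf G}\text{-}\mathcal L}{\bf Z}({\bf Y})\quad(n\to\infty)$$ for every $\mathcal X$-valued ${\bf G}$-measurable random variable ${\bf Y}$.
   Context: $\to^{{\bf G}\text{-}\mathcal L}$ denotes ${\bf G}$-stable convergence in law: $U_n\to^{{\bf G}\text{-}\mathcal L}U$, with $U$ defined on an extension of the probability space, means $E[f(U_n)V]\to E[f(U)V]$ for every bounded continuous $f$ and every bounded ${\bf G}$-measurable random variable $V$. ${\bf P}\text{-}\lim$ is the limit in probability. The functions $f_k$ are real-valued. ${\bf Z}_n({\bf Y})$ is understood as ${\bf P}\text{-}\lim_{M\to\infty}\sum_{k=1}^{K_M}{\bf Z}_{n,k}f_k({\bf Y})$. *)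

(* Defs.v *)
From HB Require Import structures.
From mathcomp Require Export all_boot all_order all_algebra.
From mathcomp Require Export all_classical all_reals all_analysis.

Set Implicit Arguments.
Unset Strict Implicit.
Unset Printing Implicit Defensive.

Import Order.TTheory GRing.Theory Num.Theory.
Export numFieldNormedType.Exports.

Local Open Scope classical_set_scope.
Local Open Scope ring_scope.

#[short(type="completeMetricType")]
HB.structure Definition CompleteMetric (K : numDomainType) :=
  {T of Complete T & Metric K T}.

Definition separable (T : topologicalType) : Prop :=
  exists2 D : set T, countable D & dense D.

Definition borel (E : ptopologicalType) := g_sigma_algebraType (@open E).

Definition borel_measurable d (T : measurableType d) (E : ptopologicalType)
    (U : T -> E) : Prop :=
  measurable_fun [set: T] (U : T -> borel E).

Definition cvg_in_prob d (T : measurableType d) (R : realType)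
    (P : probability T R) (u : nat -> T -> R) (l : T -> R) : Prop :=
  forall e : R, 0 < e ->
    (fun M => P [set w | e < `|u M w - l w|]) @ \oo --> 0%E.

Section extensions.
Context (R : realType) d (A : measurableType d) (P : probability A R)
  d' (A' : measurableType d') (P' : probability A' R) (proj : {RV P' >-> A}).

(* (A', P') extends (A, P) through the projection proj : A' -> A: a random
   variable U on A is identified with U \o proj on A'. *)
Definition is_extension : Prop :=
  forall B : set A, measurable B -> distribution P' proj B = P B.

(* N is independent of the sigma-algebra of A (pulled back to A' by proj). *)
Definition independent_of_base (E : ptopologicalType) (N : A' -> E) : Prop :=
  forall (B : set A) (C : set (borel E)), measurable B -> measurable C ->
    P' (proj @^-1` B `&` N @^-1` C) = (P' (proj @^-1` B) * P' (N @^-1` C))%E.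

(* U_ n converges to U stably with respect to the whole sigma-algebra of A. *)
Definition stable_cvg (E : ptopologicalType) (U_ : nat -> A -> E)
    (U : A' -> E) : Prop :=
  [/\ forall n, borel_measurable (U_ n), borel_measurable U &
      forall (f : E -> R) (V : {RV P >-> R}),
        continuous f -> bounded_fun f -> bounded_fun V ->
        (fun n => 'E_P[(fun w => f (U_ n w) * V w)%R]%E) @ \oo -->
        'E_P'[(fun w => f (U w) * V (proj w))%R]%E].

End extensions.

(* The entries of N are independent with law N(0, 1); normal_prob takes the
   mean and the standard deviation. *)
Definition standard_normal d (T : measurableType d) (R : realType)
    (P : probability T R) (n : nat) (N : T -> 'cV[R]_n) : Prop :=
  borel_measurable N /\
  forall C : 'I_n -> set R, (forall i, measurable (C i)) ->
    P [set w | forall i, C i (N w i 0)] =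
    (\prod_(i < n) normal_prob (0 : R) 1 (C i))%E.

Definition symmetric_nonneg (R : realType) (n : nat) (S : 'M[R]_n) : Prop :=
  S \is symmetricmx /\ forall u : 'cV[R]_n, 0 <= (u^T *m S *m u) 0 0.

(* The symmetric nonnegative definite square root of B, which exists and is
   unique if B is itself symmetric nonnegative definite; 0 if there is none. *)
Definition sqrtmx (R : realType) (n : nat) (B : 'M[R]_n) : 'M[R]_n :=
  xget 0 [set S | symmetric_nonneg S /\ S *m S = B].

(* The indices k, k' >= 1 of the usual formulation are shifted to start
   at 0: the range K_M < k <= K_M' becomes K M <= k < K M'. *)
Section fields.
Context (R : realType) (T X : Type) (K : nat -> nat).

Definition Zsum (Z : nat -> T -> R) (f : nat -> X -> R) (M : nat)
    (y : T -> X) (w : T) : R :=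
  \sum_(0 <= k < K M) Z k w * f k (y w).

Definition Vsum (V : nat -> nat -> T -> R) (f : nat -> X -> R) (M : nat)
    (x : X) (w : T) : R :=
  \sum_(0 <= k < K M) \sum_(0 <= k' < K M) V k k' w * f k x * f k' x.

Definition Vmx (V : nat -> nat -> T -> R) (m : nat) (w : T) : 'M[R]_(K m) :=
  \matrix_(k, k') V k k' w.

Definition Zvec (Z : nat -> T -> R) (m : nat) (w : T) : 'cV[R]_(K m) :=
  \col_k Z k w.

End fields.

(* Main.v *)
From HB Require Import structures.
Require Import Defs.
From mathcomp Require Import ring lra measurable_realfun.

(** Neither the Gaussian form of the limits in the first assumption nor the
    matrix [V] matters: all that is used of that assumption is that, for each
    [k], the sequence [Z_{n,k}] is tight in [n].

    Let [Y_j] be finitely valued measurable approximations of [Y], converging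
    to [Y] everywhere.  Since [Y_j] takes finitely many values on [G]-measurable
    events, which can be absorbed in the test variable, stable convergence at
    each fixed point gives [Z_n(Y_j) -> Z(Y_j)] stably; and [Z(Y_j) -> Z(Y)]
    because [Z] has continuous paths.  It remains to bound [Z_n(Y) - Z_n(Y_j)]
    in probability uniformly in large [n]: with high probability [Y] and [Y_j]
    both lie in a finite union of the sets [U_x], where the second assumption
    makes the tails of the two series small uniformly in [n], and the remaining
    finite sums [sum_k Z_{n,k} (f_k(Y) - f_k(Y_j))] are small by tightness of
    [Z_{n,k}] and continuity of [f_k]. *)

Set Implicit Arguments.
Unset Strict Implicit.
Unset Printing Implicit Defensive.

Import Order.TTheory GRing.Theory Num.Theory.

Local Open Scope classical_set_scope.
Local Open Scope ring_scope.

(** * Sets covered by measurable events of small probability *)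

Section small_events.
Context (R : realType) d (T : measurableType d) (P : probability T R).
Implicit Types (E F : set T) (e : R).

(** An outer-probability bound: [E] itself need not be measurable. It is applied to sets of the form
    [exists2 x, U x & ...] with an uncountable [U], and union bounds remain available. *)
Definition small_event E e : Prop :=
  exists B : set T, [/\ measurable B, E `<=` B & (P B <= e%:E)%E].

Lemma small_event_measurable E e :
  measurable E -> small_event E e -> (P E <= e%:E)%E.
Proof.
move=> mE [B [mB EB PB]]; apply: le_trans PB.
by rewrite le_measure ?inE.
Qed.

Lemma measurable_small_event E e :
  measurable E -> (P E <= e%:E)%E -> small_event E e.
Proof. by move=> mE PE; exists E; split. Qed.

Lemma small_event0 e : 0 <= e -> small_event set0 e.
Proof. by move=> e0; exists set0; split; rewrite ?measure0 ?lee_fin. Qed.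

Lemma small_event_le E F e e' :
  E `<=` F -> e <= e' -> small_event F e -> small_event E e'.
Proof.
move=> EF ee' [B [mB FB PB]]; exists B; split => //.
  exact: subset_trans FB.
by rewrite (le_trans PB)// lee_fin.
Qed.

Lemma small_eventU E F e e' :
  small_event E e -> small_event F e' -> small_event (E `|` F) (e + e').
Proof.
move=> [B [mB EB PB]] [C [mC FC PC]]; exists (B `|` C); split.
- exact: measurableU.
- exact: setUSS.
- by rewrite (le_trans (measureU2 _ _ _))// EFinD leeD.
Qed.

Lemma small_event_bigcup (E : nat -> set T) e n :
  (forall i, (i < n)%N -> small_event (E i) (e / n%:R)) -> 0 <= e ->
  small_event [set w | exists2 i, (i < n)%N & E i w] e.
Proof.
move=> smE e0.
have [n0|n0] := posnP n.
  apply: small_event_le (small_event0 e0) => // w [i].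
  by rewrite n0 ltn0.
have -> : e = (e / n%:R) *+ n.
  by rewrite -mulr_natr -mulrA mulVf ?mulr1// pnatr_eq0 -lt0n.
have : forall m, (m <= n)%N ->
    small_event [set w | exists2 i, (i < m)%N & E i w] ((e / n%:R) *+ m).
  elim=> [_|m IH mn].
    by apply: small_event_le (small_event0 (lexx 0)) => // w [].
  rewrite mulrSr; apply: small_event_le (small_eventU (IH (ltnW mn)) (smE _ mn)) => //.
  move=> w [i]; rewrite ltnS leq_eqVlt => /predU1P[->|im] Ei; [by right|left].
  by exists i.
exact.
Qed.

Lemma cvg0_small_event (E : nat -> set T) :
  (forall n, measurable (E n)) -> P (E n) @[n --> \oo] --> 0%E ->
  forall e, 0 < e -> \forall n \near \oo, small_event (E n) e.
Proof.
move=> mE /fine_cvgP[_ /cvgrPdist_lt cE] e e0.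
have := cE e e0; apply: filterS => n.
rewrite sub0r normrN ger0_norm ?fine_ge0// => PE.
apply: measurable_small_event => //.
by rewrite -(fineK (fin_num_measure P _ (mE n))) lee_fin ltW.
Qed.

(** The unions of the tails of [E] decrease to the upper limit of [E]. The pointwise hypothesis
    makes that limit empty, so their probabilities tend to 0 by continuity from above. *)
Lemma eventually_small_event (E : nat -> set T) :
  (forall n, measurable (E n)) ->
  (forall w, \forall n \near \oo, ~ E n w) ->
  forall e, 0 < e -> \forall n \near \oo, small_event (E n) e.
Proof.
move=> mE Enot e e0.
have cv : P (\bigcup_(k >= n) E k) @[n --> \oo] --> 0%E.
  rewrite -(measure0 P).
  have -> : set0 = lim_sup_set E.
    apply/esym/seteqP; split=> // w /= Ew.
    have [n _ nE] := Enot w.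
    by have [k /= nk Ekw] := Ew n I; exact: (nE k nk).
  apply: lim_sup_set_cvg => //.
  rewrite (le_lt_trans (probability_le1 _ _)) ?ltry//.
  exact: bigcup_measurable.
have mU n : measurable (\bigcup_(k >= n) E k) by exact: bigcup_measurable.
have := cvg0_small_event mU cv e0; apply: filterS => n.
by apply: small_event_le => // w Ew; exists n => /=.
Qed.

End small_events.

(** * Convergence in probability in terms of small events *)

Section convergence_in_probability.
Context (R : realType) d (T : measurableType d) (P : probability T R).

Lemma measurable_dist_gt (u v : T -> R) (e : R) :
  measurable_fun setT u -> measurable_fun setT v ->
  measurable [set w | e < `|u w - v w|].
Proof.
move=> mu mv.
have mf : measurable_fun setT (fun w => `|u w - v w|).
  by apply: measurableT_comp => //; exact: measurable_funB.
have := measurable_fun_ltr (measurable_cst e) mf.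
move=> /(_ measurableT [set true] I).
by rewrite setTI; congr measurable; apply/seteqP; split.
Qed.

Lemma measurable_norm_gt (u : T -> R) (a : R) :
  measurable_fun setT u -> measurable [set w | a < `|u w|].
Proof.
move=> mu; have := measurable_dist_gt a mu (measurable_cst (0 : R)).
by congr measurable; apply/seteqP; split => w /=; rewrite subr0.
Qed.

(** One parameter bounds both the deviation and the probability. To recover separate tolerances [e]
    and [e'], take the parameter [Num.min e e']. *)
Lemma cvg_in_prob_small (u : nat -> T -> R) (l : T -> R) :
  (forall n, measurable_fun setT (u n)) -> measurable_fun setT l ->
  cvg_in_prob P u l <-> (forall e, 0 < e ->
    \forall n \near \oo, small_event P [set w | e < `|u n w - l w|] e).
Proof.
move=> mu ml; have mE n e := @measurable_dist_gt (u n) l e (mu n) ml.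
split=> [cv e e0|cv e e0].
  by apply: cvg0_small_event => //; exact: cv.
apply/fine_cvgP; split; first by near=> n; rewrite fin_num_measure//; exact: mE.
apply/cvgrPdist_le => e' e'0.
have me : 0 < Num.min e e' by rewrite lt_min e0.
near=> n => /=.
rewrite sub0r normrN ger0_norm ?fine_ge0//.
rewrite -lee_fin fineK; last by rewrite fin_num_measure//; exact: mE.
apply: small_event_measurable; first exact: mE.
apply: (@small_event_le _ _ _ _ _
   [set w | Num.min e e' < `|u n w - l w|] (Num.min e e')).
- by move=> w /=; apply: le_lt_trans; rewrite ge_min lexx.
- by rewrite ge_min lexx orbT.
- by near: n; exact: (cv _ me).
Unshelve. all: by end_near. Qed.

End convergence_in_probability.

(** * Completeness for convergence in probability *)

Section completeness_in_probability.
Context (R : realType).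

Let half_gt0 k : 0 < (2^-1 : R) ^+ k.
Proof. by rewrite exprn_gt0// invr_gt0. Qed.

Lemma half_exp_lt (e : R) : 0 < e -> \forall k \near \oo, (2^-1 : R) ^+ k < e.
Proof.
move=> e0.
have : (2^-1 : R) ^+ k @[k --> \oo] --> 0.
  by apply: cvg_expr; rewrite ger0_norm ?invr_ge0// invf_lt1// ltr1n.
move=> /cvgrPdist_lt /(_ e e0); apply: filterS => k /=.
by rewrite sub0r normrN ger0_norm// ltW.
Qed.

Lemma half_cauchy_dist (u : R ^nat) n :
  (forall k, (n <= k)%N -> `|u k.+1 - u k| <= 2^-1 ^+ k) ->
  forall m, (n <= m)%N -> `|u m - u n| <= 2 * 2^-1 ^+ n.
Proof.
move=> un m nm; rewrite -(subnKC nm); set j := (m - n)%N.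
(* The induction runs on the exact partial sum of the geometric series; the stated bound alone would
   not be inductive. *)
apply: (@le_trans _ _ (2 * 2^-1 ^+ n - 2 * 2^-1 ^+ (n + j))); last first.
  by rewrite lerBlDr lerDl mulr_ge0// ltW.
elim: j => [|j IH]; first by rewrite addn0 !subrr normr0.
rewrite addnS; apply: le_trans (ler_distD (u (n + j)%N) _ _) _.
apply: le_trans (lerD (un _ (leq_addr _ _)) IH) _.
rewrite exprS; lra.
Qed.

Lemma half_cauchy_cvg (u : R ^nat) n :
  (forall k, (n <= k)%N -> `|u k.+1 - u k| <= 2^-1 ^+ k) -> cvgn u.
Proof.
move=> un; apply: cauchy_cvg; apply: cauchy_exP => e e0.
have [k [nk ke]] : exists k, (n <= k)%N /\ (2^-1 : R) ^+ k < e / 2.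
  have e20 : 0 < e / 2 by rewrite divr_gt0.
  have [k0 _ H] := half_exp_lt e20.
  by exists (maxn n k0); split; [exact: leq_maxl|apply: H; exact: leq_maxr].
exists (u k), k => //= m km; rewrite -ball_normE/= distrC.
have := half_cauchy_dist (fun l kl => un l (leq_trans nk kl)) km.
by move=> /le_lt_trans; apply; rewrite mulrC -ltr_pdivlMr.
Qed.

Context d (T : measurableType d) (P : probability T R).

(** Along a fast subsequence the increments exceed [2^-i] only with probability at most [2^-i]. By
    Borel-Cantelli the subsequence converges off a null set, and the Cauchy condition carries its
    limit over to the whole sequence. *)
Lemma cauchy_in_prob_cvg (S : nat -> T -> R) :
  (forall n, measurable_fun setT (S n)) ->
  (forall e, 0 < e -> exists N, forall m n, (N <= m)%N -> (N <= n)%N ->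
     small_event P [set w | e < `|S m w - S n w|] e) ->
  exists W : {RV P >-> R}, cvg_in_prob P S W.
Proof.
move=> mS cS.
have /choice[N NP] (i : nat) := cS _ (half_gt0 i).
(* Summing the thresholds gives a nondecreasing sequence with [N i <= M i]. *)
pose M i := (\sum_(j < i.+1) N j)%N.
have MM i : (M i <= M i.+1)%N by rewrite /M [leqRHS]big_ord_recr/= leq_addr.
have NM i : (N i <= M i)%N by rewrite /M big_ord_recr/= leq_addl.
pose u i := S (M i).
pose F i := [set w | 2^-1 ^+ i < `|u i.+1 w - u i w|].
have mF i : measurable (F i) .
  by apply: measurable_dist_gt; exact: mS.
have PF i : (P (F i) <= ((2^-1 : R) ^+ i)%:E)%E.
  apply: small_event_measurable => //; apply: NP => //.
  exact: leq_trans (NM i) (MM i).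
have mU n : measurable (\bigcup_(k >= n) F k).
  by apply: bigcup_measurable => k _; exact: mF.
have mD : measurable (lim_sup_set F).
  by apply: bigcap_measurable => //; exists 0%N.
have D0 : P (lim_sup_set F) = 0%E.
  apply: lim_sup_set_cvg0 => //.
  apply: (@le_lt_trans _ _ (\sum_(n <oo) ((2^-1 : R) ^+ n)%:E)%E).
    by apply: lee_nneseries => // n _; exact: PF.
  have cg : (series (geometric 1 (2^-1 : R))) @ \oo --> (1 * (1 - 2^-1)^-1 : R).
    by apply: cvg_geometric_series; rewrite ger0_norm ?invr_ge0// invf_lt1// ltr1n.
  have : (fun n => (series (geometric 1 (2^-1 : R)) n)%:E) @ \oo -->
      (1 * (1 - 2^-1)^-1 : R)%:E.
    by apply: cvg_EFin => //; exact: nearW.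
  move=> H; rewrite (_ : (\sum_(n <oo) _)%E = (1 * (1 - 2^-1)^-1 : R)%:E) ?ltry//.
  apply/cvg_lim => //; apply: cvg_trans H; apply: near_eq_cvg.
  apply: nearW => n /=; rewrite -sumEFin; apply: eq_bigr => i _.
  by rewrite /geometric/= mul1r.
(* Setting the subsequence to 0 on the exceptional null set makes it converge everywhere, so that
   its limit is measurable. *)
pose v i w := u i w * \1_(~` lim_sup_set F) w.
have mv i : measurable_fun setT (v i).
  apply: measurable_funM => //; first exact: mS.
  by apply: measurable_indic; exact: measurableC.
have offF w n : ~ (\bigcup_(k >= n) F k) w ->
    forall k, (n <= k)%N -> `|u k.+1 w - u k w| <= 2^-1 ^+ k.
  by move=> nF k nk; rewrite leNgt; apply/negP => Fk; apply: nF; exists k.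
have cv w : cvgn (v ^~ w).
  rewrite /v; have [Dw|Dw] := pselect (lim_sup_set F w).
    rewrite (_ : (fun i => _) = cst 0); first exact: is_cvg_cst.
    apply/funext => i; rewrite indicE memNset/= ?mulr0//.
  rewrite (_ : (fun i => _) = u ^~ w); last first.
    by apply/funext => i; rewrite indicE mem_set/= ?mulr1.
  have [n nF] : exists n, ~ (\bigcup_(k >= n) F k) w.
    by apply/existsNP => H; apply: Dw => n _; exact: H.
  exact: (half_cauchy_cvg (offF _ _ nF)).
pose W w := limn (v ^~ w).
have mW : measurable_fun setT W.
  by apply: (measurable_fun_cvg mv) => w _; exact: cv.
pose Wm := isMeasurableFun.Build _ _ _ _ W mW.
pose WR : {RV P >-> R} := HB.pack W Wm.
exists WR; apply/cvg_in_prob_small => // e e0.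
have tail : \forall n \near \oo, small_event P (\bigcup_(k >= n) F k) (e / 2).
  have cvU : P (\bigcup_(k >= n) F k) @[n --> \oo] --> 0%E.
    rewrite -D0; apply: lim_sup_set_cvg => //.
    by rewrite (le_lt_trans (probability_le1 _ _)) ?ltry//.
  by apply: cvg0_small_event => //; rewrite divr_gt0.
(* The deviation will be at most [2^-n] from [S m] to [u n] plus [2 * 2^-n] from [u n] to the limit,
   hence [e / 3]; the probabilities add up to at most [2^-n + e / 2]. *)
have [n [tailn ne]] : exists n,
    small_event P (\bigcup_(k >= n) F k) (e / 2) /\ (2^-1 : R) ^+ n < e / 3.
  have e30 : 0 < e / 3 by rewrite divr_gt0.
  have [n _ H] := filterI tail (half_exp_lt e30).
  by exists n; apply: H => /=.
near=> m.
have NPm : small_event P [set w | (2^-1 : R) ^+ n < `|S m w - u n w|] (2^-1 ^+ n).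
  by apply: NP => //; near: m; exists (N n).
have := small_eventU NPm tailn; apply: small_event_le => [w /= eW|]; last lra.
apply: contrapT => /not_orP[/negP]; rewrite -leNgt => Smn nF.
move: eW; rewrite ltNge => /negP; apply.
have uW : `|u n w - W w| <= 2 * 2^-1 ^+ n.
  have vu : v ^~ w = u ^~ w.
    apply/funext => i; rewrite /v indicE mem_set/= ?mulr1//.
    by move=> /(_ n I).
  rewrite /W vu distrC.
  have cu : cvgn (u ^~ w) by rewrite -vu; exact: cv.
  have cd : `|u k w - u n w| @[k --> \oo] --> `|limn (u ^~ w) - u n w|.
    by apply: cvg_norm; apply: cvgB => //; exact: cvg_cst.
  rewrite -(cvg_lim _ cd)//; apply: limr_le.
    by apply/cvg_ex; exists (`|limn (u ^~ w) - u n w|).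
  exists n => // k /= nk.
  exact: (half_cauchy_dist (offF _ _ nF)).
apply: le_trans (ler_distD (u n w) _ _) _.
by apply: le_trans (lerD Smn uW) _; lra.
Unshelve. all: by end_near. Qed.

End completeness_in_probability.

(** * Borel measurability and continuous functions *)

Section borel_measurability.
Context (R : realType) d (T : measurableType d).

Lemma measurable_continuous_comp (E : ptopologicalType) (Y : T -> E) (g : E -> R) :
  borel_measurable Y -> continuous g -> measurable_fun setT (g \o Y).
Proof.
move=> mY cg; apply: (measurability _ (RGenOInfty.measurableE R)) => //.
move=> /= _ [_ [a ->] <-]; rewrite setTI comp_preimage.
have oga : open (g @^-1` `]a, +oo[).
  by move/continuousP : cg; apply; exact: interval_open.
rewrite -[X in measurable X]setTI.
by apply: (mY measurableT); exact: sub_sigma_algebra.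
Qed.

Lemma borel_measurable_real (u : T -> R) :
  measurable_fun setT u -> borel_measurable u.
Proof.
move=> mu.
apply: (@measurability _ _ T (borel R) setT u (@open R)) => //.
move=> _ [B oB <-]; apply: mu => //; exact: open_measurable.
Qed.

End borel_measurability.

(** * Dense sequences and nearest-point approximation *)

Section separable_metric_space.
Context (R : realType) (X : completeMetricType R).

Lemma separable_seq : separable X -> exists x_ : nat -> X, dense (range x_).
Proof.
move=> [D cD dD].
have [D0|[h]] := pfcard_geP cD.
  by exfalso; apply: (@dense0 X); rewrite -D0.
exists h; suff -> : range h = D by [].
apply/seteqP; split; last exact: surj.
by move=> _ [n _ <-]; exact: funS.
Qed.

Variables (x_ : nat -> X).
Hypothesis dense_x : dense (range x_).

Lemma dense_seq_open (U : set X) : open U -> U !=set0 -> exists i, U (x_ i).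
Proof. by move=> oU U0; have [x [Ux [i _ ix]]] := dense_x U0 oU; exists i; rewrite ix. Qed.

(** For fixed [w], the points of [U] with [c < h w x] form an open set, which is nonempty only if it
    meets the dense sequence. The uncountable union over [U] is thus a countable one. *)
Lemma measurable_exists_gt d (T : measurableType d) (h : T -> X -> R)
    (U : set X) (c : R) : open U ->
  (forall x, measurable_fun setT (h ^~ x)) -> (forall w, continuous (h w)) ->
  measurable [set w | exists2 x, U x & c < h w x].
Proof.
move=> oU mh ch.
rewrite (_ : [set w | _] =
    \bigcup_(i in [set i | U (x_ i)]) [set w | c < h w (x_ i)]).
  apply: bigcup_measurable => i _.
  have := measurable_fun_ltr (measurable_cst c) (mh (x_ i)).
  move=> /(_ measurableT [set true] I).
  by rewrite setTI; congr measurable; apply/seteqP; split.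
apply/seteqP; split => [w [x Ux cx]|w [i /= Ui ci]]; last by exists (x_ i).
have [| |i [Ui /= hi]] := @dense_seq_open (U `&` h w @^-1` `]c, +oo[).
- apply: openI => //.
  by move/continuousP : (ch w); apply; exact: interval_open.
- by exists x; split => //=; rewrite in_itv/= cx.
- by exists i => //=; move: hi; rewrite in_itv/= andbT.
Qed.

(* Index of the first of the points x_0, ..., x_j closest to y. *)
Fixpoint nearest (j : nat) (y : X) : nat :=
  if j is j'.+1 then
    if mdist y (x_ j) < mdist y (x_ (nearest j' y)) then j else nearest j' y
  else 0%N.

Lemma nearest_leq j y : (nearest j y <= j)%N.
Proof. by elim: j => //= j IH; case: ifP => // _; exact: leqW. Qed.

Lemma nearest_le j y i : (i <= j)%N ->
  mdist y (x_ (nearest j y)) <= mdist y (x_ i).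
Proof.
elim: j => [|j IH]; first by rewrite leqn0 => /eqP ->.
rewrite leq_eqVlt => /predU1P[->|]/=.
  by case: ltP.
rewrite ltnS => /IH; case: ltP => // /ltW; exact: le_trans.
Qed.

Lemma nearest_cvg y : x_ (nearest j y) @[j --> \oo] --> y.
Proof.
apply/cvg_ballP => e e0.
have [| |i yi] := @dense_seq_open (ball y e)^°; first exact: open_interior.
  by exists y; exact: nbhsx_ballx.
exists i => // j /= ij; rewrite ballEmdist/=.
apply: le_lt_trans (nearest_le _ ij) _.
by have := interior_subset yi; rewrite ballEmdist.
Qed.

Lemma continuous_mdist (z : X) : continuous (fun y : X => mdist y z).
Proof.
move=> y; apply/cvgrPdist_lt => e e0.
have : nbhs y (ball y e) by exact: nbhsx_ballx.
apply: filterS => y'; rewrite ballEmdist /= => yy'.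
have := metric_triangle y y' z; have := metric_triangle y' y z.
rewrite (metric_sym y' y) => H1 H2.
by rewrite ltr_norml; apply/andP; split; lra.
Qed.

Lemma measurable_nearest d (T : measurableType d) (Y : T -> X) j :
  borel_measurable Y -> measurable_fun setT (fun w => nearest j (Y w)).
Proof.
move=> mY.
have mdY i : measurable_fun setT (fun w => mdist (Y w) (x_ i)).
  exact: (measurable_continuous_comp mY (@continuous_mdist (x_ i))).
(* The recursion branches on the distance to the current nearest point, so the measurability of that
   distance is carried through the induction. *)
suff : measurable_fun setT (fun w => nearest j (Y w)) /\
    measurable_fun setT (fun w => mdist (Y w) (x_ (nearest j (Y w)))) by case.
elim: j => [|j [IH1 IH2]]; first by split; [exact: measurable_cst|exact: mdY].
have mlt : measurable_fun setT
    (fun w => mdist (Y w) (x_ j.+1) < mdist (Y w) (x_ (nearest j (Y w)))).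
  exact: measurable_fun_ltr.
split => /=; first exact: measurable_fun_ifT.
rewrite (_ : (fun w => _) = (fun w => if mdist (Y w) (x_ j.+1) <
    mdist (Y w) (x_ (nearest j (Y w))) then mdist (Y w) (x_ j.+1)
    else mdist (Y w) (x_ (nearest j (Y w))))); first exact: measurable_fun_ifT.
by apply/funext => w; case: ifP.
Qed.

End separable_metric_space.

(** * Integrals of bounded random variables *)

Section bounded_integrals.
Context (R : realType) d (T : measurableType d) (P : probability T R).
Implicit Types h : T -> R.

Lemma bounded_funP (U : Type) (h : U -> R) :
  bounded_fun h <-> exists2 C, 0 < C & forall w, `|h w| <= C.
Proof.
split=> [/ex_strict_bound_gt0[C C0 hC]|[C C0 hC]].
  by exists C => // w; apply: ltW; exact: (hC w I).
exists C; split; first exact: num_real.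
by move=> M CM w _ /=; rewrite (le_trans (hC w))// ltW.
Qed.

Lemma bounded_integrable h C : measurable_fun setT h ->
  (forall w, `|h w| <= C) -> P.-integrable setT (EFin \o h).
Proof.
move=> mh hC; apply: measurable_bounded_integrable => //.
  by rewrite (le_lt_trans (probability_le1 _ _)) ?ltry.
exists C; split; first exact: num_real.
by move=> M CM w _ /=; rewrite (le_trans (hC w))// ltW.
Qed.

Lemma expectation_bounded h C : measurable_fun setT h ->
  (forall w, `|h w| <= C) -> 'E_P[h]%E = (\int[P]_w h w)%:E.
Proof.
move=> mh hC; rewrite unlock /Rintegral fineK//.
by apply: integrable_fin_num => //; exact: bounded_integrable hC.
Qed.

(** With [B] a measurable cover of [E] as in [small_event], [|h| <= c + C * \1_B] holds everywhere;
    integrate. *)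
Lemma normr_Rintegral_le_small h E (c C e : R) : measurable_fun setT h ->
  0 <= c -> (forall w, `|h w| <= C) -> (forall w, ~ E w -> `|h w| <= c) ->
  small_event P E e -> `|\int[P]_w h w| <= c + C * e.
Proof.
move=> mh c0 hC hc [B [mB EB PB]].
have C0 : 0 <= C by exact: le_trans (hC point).
have ih := bounded_integrable mh hC.
apply: le_trans (le_normr_Rintegral measurableT ih) _.
have mB1 : measurable_fun setT (\1_B : T -> R) by exact: measurable_indic.
have iB : P.-integrable setT (EFin \o (fun w => c + C * \1_B w)).
  apply: (@bounded_integrable _ (c + C)).
    by apply: measurable_funD => //; apply: measurable_funM.
  by move=> w; rewrite indicE; case: (w \in B) => /=; rewrite ler_norml; lra.
apply: (@le_trans _ _ (\int[P]_w (c + C * \1_B w))).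
  apply: le_Rintegral => //.
    apply: (@bounded_integrable _ C); first exact: measurableT_comp.
    by move=> w; rewrite normr_id.
  move=> w _; rewrite indicE.
  have [wB|wB] := boolP (w \in B); first by rewrite mulr1 (le_trans (hC w))// lerDr.
  rewrite mulr0 addr0 hc// => /EB.
  by rewrite -in_setE; exact/negP.
have i1 : P.-integrable setT (EFin \o (\1_B : T -> R)).
  apply: (@bounded_integrable _ 1) => // w.
  by rewrite indicE; case: (w \in B) => /=; rewrite ?normr1 ?normr0.
rewrite RintegralD//; last 2 first.
  by apply: (@bounded_integrable _ `|c|).
  apply: (@bounded_integrable _ C); first exact: measurable_funM.
  by move=> w; rewrite indicE; case: (w \in B) => /=; rewrite ler_norml; lra.
rewrite Rintegral_cst// [X in fine X](@probability_setT _ _ _ P) mulr1 lerD2l.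
rewrite RintegralZl// ler_wpM2l//.
rewrite /Rintegral integral_indic// setIT -lee_fin fineK//.
by rewrite fin_num_measure.
Qed.

Lemma probability_le_Rintegral h E C : measurable_fun setT h -> measurable E ->
  (forall w, 0 <= h w <= C) -> (forall w, E w -> 1 <= h w) ->
  (P E <= (\int[P]_w h w)%:E)%E.
Proof.
move=> mh mE h0 hE.
have -> : P E = (\int[P]_w (\1_E w : R))%:E.
  rewrite /Rintegral integral_indic// setIT fineK//.
  by rewrite fin_num_measure.
rewrite lee_fin; apply: le_Rintegral => //.
- apply: (@bounded_integrable _ 1); first exact: measurable_indic.
  by move=> w; rewrite indicE; case: (w \in E) => /=; rewrite ?normr1 ?normr0.
- apply: (@bounded_integrable _ C) => // w.
  by have /andP[h1 h2] := h0 w; rewrite ger0_norm.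
- move=> w _; rewrite indicE; have [wE|wE] := boolP (w \in E).
    by apply: hE; exact/set_mem.
  by have /andP[] := h0 w.
Qed.

Lemma Rintegral_bounded_cvg (h_ : nat -> T -> R) h C :
  (forall n, measurable_fun setT (h_ n)) -> (forall n w, `|h_ n w| <= C) ->
  (forall w, h_ n w @[n --> \oo] --> h w) ->
  \int[P]_w h_ n w @[n --> \oo] --> \int[P]_w h w.
Proof.
move=> mh hC cvh.
have mhl : measurable_fun setT h by apply: (measurable_fun_cvg mh) => w _.
have [|||||] := @dominated_convergence _ _ _ P setT measurableT
  (fun n => EFin \o h_ n) (EFin \o h) (EFin \o cst C).
- by move=> n; exact/measurable_EFinP.
- exact/measurable_EFinP.
- by apply: aeW => w _; apply: cvg_EFin; [exact: nearW|exact: cvh].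
- by apply: (@bounded_integrable _ `|C|) => //; exact: measurable_cst.
- by apply: aeW => w n _; rewrite /= lee_fin.
move=> ih _ cv.
apply: fine_cvg; apply: cvg_trans cv _.
by rewrite /Rintegral fineK//; exact: integrable_fin_num.
Qed.

Lemma Rintegral_sum (h : nat -> T -> R) C m :
  (forall i, measurable_fun setT (h i)) -> (forall i w, `|h i w| <= C) ->
  \int[P]_w (\sum_(i < m) h i w) = \sum_(i < m) \int[P]_w h i w.
Proof.
move=> mh hC; elim: m => [|m IH].
  rewrite big_ord0; under eq_Rintegral do rewrite big_ord0.
  by rewrite Rintegral_cst// mul0r.
rewrite big_ord_recr/= -IH.
under eq_Rintegral do rewrite big_ord_recr/=.
rewrite RintegralD//; last exact: bounded_integrable (hC m).
apply: (@bounded_integrable _ (C * m%:R)); first exact: measurable_sum.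
move=> w; apply: le_trans (ler_norm_sum _ _ _) _.
by rewrite mulr_natr -[leRHS]/(C *+ m) -[m in leRHS]card_ord -sumr_const ler_sum.
Qed.

End bounded_integrals.

(** * Continuous truncation and tail probabilities *)

Section truncation.
Context (R : realType).

(* The continuous approximation of the indicator of [|t| > a] that vanishes
   for [|t| <= a] and equals 1 for [|t| >= a + 1]. *)
Definition ramp (a t : R) : R := (1 + `| `|t| - a| - `| `|t| - a - 1|) / 2.

Lemma ramp_ge0_le1 a t : 0 <= ramp a t <= 1.
Proof.
rewrite /ramp; have := ler_norm (`|t| - a); have := ler_norm (- (`|t| - a)).
have := ler_norm (`|t| - a - 1); have := ler_norm (- (`|t| - a - 1)).
rewrite !normrN => H1 H2 H3 H4.
have : `| `|t| - a - 1| <= `| `|t| - a| + 1.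
  by apply: le_trans (ler_normB _ _) _; rewrite normr1.
have : `| `|t| - a| <= `| `|t| - a - 1| + 1.
  by rewrite -{1}(subrK 1 (`|t| - a)); apply: le_trans (ler_normD _ _) _; rewrite normr1.
by move=> H5 H6; apply/andP; split; lra.
Qed.

Lemma ramp_eq0 a t : `|t| <= a -> ramp a t = 0.
Proof.
move=> ta; rewrite /ramp.
have -> : `| `|t| - a| = a - `|t| by rewrite distrC ger0_norm// subr_ge0.
have -> : `| `|t| - a - 1| = 1 + a - `|t|.
  by rewrite distrC ger0_norm; lra.
lra.
Qed.

Lemma ramp_eq1 a t : a + 1 <= `|t| -> ramp a t = 1.
Proof.
move=> ta; rewrite /ramp.
have -> : `| `|t| - a| = `|t| - a by rewrite ger0_norm; lra.
have -> : `| `|t| - a - 1| = `|t| - a - 1 by rewrite ger0_norm; lra.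
lra.
Qed.

Lemma continuous_ramp a : continuous (ramp a).
Proof.
move=> t; rewrite /ramp; apply: cvgM; last exact: cvg_cst.
have cn : `|t'| - a @[t' --> t] --> `|t| - a.
  by apply: cvgB; [apply: cvg_norm; exact: cvg_id|exact: cvg_cst].
apply: cvgB; first apply: cvgD; first exact: cvg_cst.
  exact: cvg_norm.
by apply: cvg_norm; apply: cvgB => //; exact: cvg_cst.
Qed.

Lemma bounded_ramp a : bounded_fun (ramp a).
Proof.
apply/bounded_funP; exists 1 => // t.
by have /andP[h0 h1] := ramp_ge0_le1 a t; rewrite ger0_norm.
Qed.

(** Compactness of the segment makes the local moduli of continuity uniform. Only [s] is confined to
    the segment: [t] may leave it, so uniform continuity of the restriction of [g] would not be
    enough. *)
Lemma continuous_segment_modulus (g : R -> R) (a e : R) :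
  continuous g -> 0 < e ->
  exists2 eta, 0 < eta &
    forall s t, `|s| <= a -> `|s - t| <= eta -> `|g s - g t| <= e.
Proof.
move=> cg e0.
have e20 : 0 < e / 2 by rewrite divr_gt0.
have /compact_near_coveringP := @segment_compact R (- a) a.
move=> /(_ R 0^'+ (fun eta s => forall t, `|s - t| <= eta -> `|g s - g t| <= e)).
move=> /(_ _)[s _|]; last first.
  move=> eta [eta0 etaP].
  have eta20 : 0 < eta / 2 by rewrite divr_gt0.
  exists (eta / 2) => // s t sa; apply: (etaP (eta / 2)) => //=.
    by rewrite sub0r normrN ger0_norm ?ltr_pdivrMr ?ltr_pMr ?ltr1n// ltW.
  by rewrite in_itv/= -ler_norml.
have /cvgrPdist_le /(_ _ e20) := cg s.
move=> [r /= r0 rP].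
(* Half the radius for the ball and half for [eta] keep both [s'] and [t] within [r] of the centre
   [s]. *)
have r20 : 0 < r / 2 by rewrite divr_gt0.
exists (ball s (r / 2), [set eta | eta < r / 2]) => /=.
  by split; [exact: nbhsx_ballx|exact: nbhs_right_lt].
move=> [s' eta] /= [ss' etar] t s't.
have gs : `|g s - g s'| <= e / 2.
  by apply: rP => /=; apply: lt_le_trans ss' _; lra.
have gt : `|g s - g t| <= e / 2.
  apply: rP => /=; apply: le_lt_trans (ler_distD s' _ _) _.
  by rewrite -ball_normE /= in ss'; lra.
rewrite (le_trans (ler_distD (g s) _ _))// (distrC (g s')); lra.
Qed.

Context d (T : measurableType d) (P : probability T R).
Implicit Types u : T -> R.

Lemma eventually_small_norm_gt u (e : R) : measurable_fun setT u -> 0 < e ->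
  exists k : nat, small_event P [set w | k%:R < `|u w|] e.
Proof.
move=> mu e0.
have [k _ kP] : \forall k \near \oo, small_event P [set w | k%:R < `|u w|] e.
  apply: eventually_small_event => // [n|w]; first exact: measurable_norm_gt.
  near=> n => /=; apply/negP; rewrite -leNgt; near: n.
  exact: nbhs_infty_ger.
by exists k; exact: kP (leqnn k).
Unshelve. all: by end_near. Qed.

Lemma measurable_ramp u a : measurable_fun setT u ->
  measurable_fun setT (fun w => ramp a (u w)).
Proof.
move=> mu; have := continuous_measurable_fun (@continuous_ramp a).
by move=> /measurableT_comp; exact.
Qed.

(** The ramp lies between the indicators of [a + 1 <= |t|] and [a < |t|]. With [small_event_ramp],
    this turns tail bounds into integrals of a bounded continuous function and back, the level
    rising by 1. *)
Lemma Rintegral_ramp_le u (a e : R) : measurable_fun setT u ->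
  small_event P [set w | a < `|u w|] e -> \int[P]_w ramp a (u w) <= e.
Proof.
move=> mu small; rewrite (le_trans (ler_norm _))//.
rewrite -[leRHS]add0r -[leRHS]mul1r mulrDr mulr0.
apply: (normr_Rintegral_le_small _ _ _ _ small) => //.
- exact: measurable_ramp.
- by move=> w; have /andP[h0 h1] := ramp_ge0_le1 a (u w); rewrite ger0_norm.
- by move=> w /= /negP; rewrite -leNgt => wa; rewrite ramp_eq0// normr0.
Qed.

Lemma small_event_ramp u (a e : R) : measurable_fun setT u ->
  \int[P]_w ramp a (u w) <= e -> small_event P [set w | a + 1 < `|u w|] e.
Proof.
move=> mu ue; have mE := measurable_norm_gt (a + 1) mu.
apply: measurable_small_event => //.
apply: (@le_trans _ _ (\int[P]_w (ramp a (u w)))%:E); last by rewrite lee_fin.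
apply: (@probability_le_Rintegral _ _ _ _ _ _ 1) => //.
- exact: measurable_ramp.
- by move=> w; exact: ramp_ge0_le1.
- by move=> w /= /ltW aw; rewrite ramp_eq1.
Qed.

End truncation.

(** * Stable convergence through real integrals, and tightness *)

Section stable_convergence.
Context (R : realType) d (A : measurableType d) (P : probability A R)
  d' (A' : measurableType d') (P' : probability A' R) (proj : {RV P' >-> A}).

Lemma measurable_test (E : ptopologicalType) d0 (T : measurableType d0)
    (U : T -> E) (g : E -> R) (V : T -> R) :
  borel_measurable U -> continuous g -> measurable_fun setT V ->
  measurable_fun setT (fun w => g (U w) * V w).
Proof.
by move=> mU cg mV; apply: measurable_funM => //; exact: measurable_continuous_comp.
Qed.

(** All the integrands are bounded, so the extended-real expectations are finite and can be replaced
    by real integrals. *)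
Lemma stable_cvgP (E : ptopologicalType) (U_ : nat -> A -> E) (U : A' -> E) :
  (forall n, borel_measurable (U_ n)) -> borel_measurable U ->
  stable_cvg P proj U_ U <->
  (forall (g : E -> R) (V : {RV P >-> R}),
     continuous g -> bounded_fun g -> bounded_fun V ->
     \int[P]_w (g (U_ n w) * V w) @[n --> \oo] -->
     \int[P']_w (g (U w) * V (proj w))).
Proof.
move=> mU_ mU.
have EP (g : E -> R) (V : {RV P >-> R}) :
    continuous g -> bounded_fun g -> bounded_fun V ->
    (forall n, 'E_P[fun w => (g (U_ n w) * V w)%R] =
       (\int[P]_w (g (U_ n w) * V w))%:E)%E /\
    ('E_P'[fun w => (g (U w) * V (proj w))%R] =
       (\int[P']_w (g (U w) * V (proj w)))%:E)%E.
  move=> cg /bounded_funP[C C0 gC] /bounded_funP[D D0 VD].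
  split => [n|].
    apply: (@expectation_bounded _ _ _ _ _ (C * D)); first exact: measurable_test.
    by move=> w; rewrite normrM ler_pM.
  apply: (@expectation_bounded _ _ _ _ _ (C * D)).
    by apply: measurable_test => //; exact: measurableT_comp.
  by move=> w; rewrite normrM ler_pM.
split=> [[_ _ cv] g V cg bg bV|cv].
  have [En E'] := EP g V cg bg bV.
  have := cv g V cg bg bV; under eq_fun do rewrite En.
  rewrite E' => /fine_cvgP[_]; exact.
split => // g V cg bg bV; have [En E'] := EP g V cg bg bV.
rewrite E'; under eq_fun do rewrite En.
by apply: cvg_EFin; [exact: nearW|exact: cv].
Qed.

Lemma stable_cvg_ramp (E : ptopologicalType) (U_ : nat -> A -> E) (U : A' -> E)
    (phi : E -> R) (a : R) : stable_cvg P proj U_ U -> continuous phi ->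
  \int[P]_w ramp a (phi (U_ n w)) @[n --> \oo] --> \int[P']_w ramp a (phi (U w)).
Proof.
move=> sU cphi; have [mU_ mU _] := sU.
have cg : continuous (ramp a \o phi).
  by move=> x; apply: continuous_comp; [exact: cphi|exact: continuous_ramp].
have bg : bounded_fun (ramp a \o phi).
  have /bounded_funP[C C0 CP] := bounded_ramp a.
  by apply/bounded_funP; exists C => // x; exact: CP.
have b1 : bounded_fun (cst 1 : {RV P >-> R}).
  by apply/bounded_funP; exists 1 => // x; rewrite normr1.
have /stable_cvgP := sU; move=> /(_ mU_ mU) /(_ _ _ cg bg b1) /=.
under eq_fun do under eq_Rintegral do rewrite mulr1.
by under eq_Rintegral do rewrite mulr1.
Qed.

(** The single variable [phi \o U] has small tails; integrals of the ramp, tested against the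
    constant 1, carry this over to [phi \o U_ n] for large [n]. *)
Lemma stable_cvg_tight (E : ptopologicalType) (U_ : nat -> A -> E) (U : A' -> E)
    (phi : E -> R) : stable_cvg P proj U_ U -> continuous phi ->
  forall e, 0 < e -> exists2 a, 0 < a &
    \forall n \near \oo, small_event P [set w | a < `|phi (U_ n w)|] e.
Proof.
move=> sU cphi e e0; have [mU_ mU _] := sU.
have e20 : 0 < e / 2 by rewrite divr_gt0.
have mphiU := measurable_continuous_comp mU cphi.
have [k kP] := eventually_small_norm_gt P' mphiU e20.
exists (k%:R + 1); first by rewrite ltr_wpDl// ler0n.
have := @stable_cvg_ramp _ _ _ _ k%:R sU cphi.
move=> /cvgrPdist_lt /(_ _ e20); apply: filterS => n /= close.
have mphiUn := measurable_continuous_comp (mU_ n) cphi.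
apply: (small_event_ramp mphiUn).
have := Rintegral_ramp_le mphiU kP; move: close => /=.
by rewrite ltr_norml => /andP[h1 h2] h3; lra.
Qed.

End stable_convergence.

(** * Gluing and approximation of stably convergent sequences *)

Section stable_convergence_operations.
Context (R : realType) d (A : measurableType d) (P : probability A R)
  d' (A' : measurableType d') (P' : probability A' R) (proj : {RV P' >-> A}).

Lemma sum_indic_fiber (T : Type) (G : nat -> T -> R) (i_ : T -> nat) m w :
  (i_ w < m)%N -> G (i_ w) w = \sum_(i < m) G i w * \1_(i_ @^-1` [set (i : nat)]) w.
Proof.
move=> im; rewrite (bigD1 (Ordinal im))//= big1 ?addr0.
  by rewrite indicE mem_set ?mulr1.
move=> i /negP ii; rewrite indicE memNset ?mulr0//= => iw.
by apply: ii; apply/eqP/val_inj.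
Qed.

Lemma measurable_glue d0 (T : measurableType d0) (G : nat -> T -> R)
    (i_ : T -> nat) m :
  (forall i, measurable_fun setT (G i)) -> measurable_fun setT i_ ->
  (forall w, (i_ w < m)%N) -> measurable_fun setT (fun w => G (i_ w) w).
Proof.
move=> mG mi im; under eq_fun do rewrite (sum_indic_fiber _ (im _)).
apply: measurable_sum => i; apply: measurable_funM => //.
by apply: measurable_indic; rewrite -[X in measurable X]setTI; exact: mi.
Qed.

Lemma stable_cvg_glue (S : nat -> nat -> A -> R) (U : nat -> A' -> R)
    (i_ : A -> nat) m :
  (forall n i, measurable_fun setT (S n i)) ->
  (forall i, measurable_fun setT (U i)) ->
  measurable_fun setT i_ -> (forall w, (i_ w < m)%N) ->
  (forall i, stable_cvg P proj (S ^~ i) (U i)) ->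
  stable_cvg P proj (fun n w => S n (i_ w) w) (fun w => U (i_ (proj w)) w).
Proof.
move=> mS mU mi im sS.
have mip : measurable_fun setT (i_ \o proj) by exact: measurableT_comp.
have bmS n i := borel_measurable_real (mS n i).
have bmU i := borel_measurable_real (mU i).
have m1 (i : nat) : measurable (i_ @^-1` [set i]).
  by rewrite -[X in measurable X]setTI; exact: mi.
apply/stable_cvgP.
- by move=> n; apply: borel_measurable_real; exact: measurable_glue mi im.
- by apply: borel_measurable_real; apply: (measurable_glue mU mip) => w; exact: im.
move=> g V cg bg bV.
(* The event that selects branch [i] is measurable on the base space, so its indicator can be
   absorbed in the test variable. Convergence in law alone would not allow this. *)
pose W i : {RV P >-> R} := V \* indic_mfun (i_ @^-1` [set i]) (m1 i).
have [C C0 gC] := (bounded_funP g).1 bg; have [D D0 VD] := (bounded_funP V).1 bV.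
have WE i w : W i w = V w * \1_(i_ @^-1` [set i]) w by [].
have WD i w : `|W i w| <= D.
  rewrite WE normrM indicE; case: (_ \in _) => /=.
    by rewrite normr1 mulr1.
  by rewrite normr0 mulr0 ltW.
have bW i : bounded_fun (W i) by apply/bounded_funP; exists D.
have En n : \int[P]_w (g (S n (i_ w) w) * V w) =
    \sum_(i < m) \int[P]_w (g (S n i w) * W i w).
  rewrite -(@Rintegral_sum _ _ _ _ (fun i w => g (S n i w) * W i w) (C * D)).
  - apply: eq_Rintegral => w _.
    rewrite (sum_indic_fiber (fun i w => g (S n i w) * V w) (im w)).
    by apply: eq_bigr => i _; rewrite WE mulrA.
  - by move=> i; exact: measurable_test.
  - by move=> i w; rewrite normrM ler_pM.
have E' : \int[P']_w (g (U (i_ (proj w)) w) * V (proj w)) =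
    \sum_(i < m) \int[P']_w (g (U i w) * W i (proj w)).
  rewrite -(@Rintegral_sum _ _ _ _ (fun i w => g (U i w) * W i (proj w)) (C * D)).
  - apply: eq_Rintegral => w _.
    rewrite (@sum_indic_fiber _ (fun i w => g (U i w) * V (proj w)) (i_ \o proj) m w (im _)).
    by apply: eq_bigr => i _; rewrite WE mulrA.
  - by move=> i; apply: measurable_test => //; exact: measurableT_comp.
  - by move=> i w; rewrite normrM ler_pM.
under eq_fun do rewrite En; rewrite E'.
apply: cvg_big => [|i _]; first exact: add_continuous.
by have /stable_cvgP := sS i; apply.
Qed.

(* Billingsley's approximation theorem for convergence in law, in its stable form. *)
Lemma stable_cvg_approx (S : nat -> A -> R) (Sj : nat -> nat -> A -> R)
    (U : A' -> R) (Uj : nat -> A' -> R) :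
  (forall n, measurable_fun setT (S n)) ->
  (forall j, stable_cvg P proj (fun n => Sj n j) (Uj j)) ->
  (forall w, Uj j w @[j --> \oo] --> U w) ->
  (forall e, 0 < e -> \forall j \near \oo, \forall n \near \oo,
     small_event P [set w | e < `|S n w - Sj n j w|] e) ->
  stable_cvg P proj S U.
Proof.
move=> mS sS cU close.
have bmSj n j : borel_measurable (Sj n j) by have [] := sS j.
have bmUj j : borel_measurable (Uj j) by have [] := sS j.
have cid : continuous (id : R -> R) by move=> x; exact: cvg_id.
have mSj n j : measurable_fun setT (Sj n j).
  exact: (measurable_continuous_comp (bmSj n j) cid).
have mUj j : measurable_fun setT (Uj j).
  exact: (measurable_continuous_comp (bmUj j) cid).
have mU : measurable_fun setT U by apply: (measurable_fun_cvg mUj) => w _.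
have bmS n := borel_measurable_real (mS n).
have bmU := borel_measurable_real mU.
apply/stable_cvgP => // g V cg bg bV.
have [C C0 gC] := (bounded_funP g).1 bg; have [D D0 VD] := (bounded_funP V).1 bV.
have cvUj : \int[P']_w (g (Uj j w) * V (proj w)) @[j --> \oo] -->
    \int[P']_w (g (U w) * V (proj w)).
  apply: (@Rintegral_bounded_cvg _ _ _ _ _ _ (C * D)).
  - by move=> j; apply: measurable_test => //; exact: measurableT_comp.
  - by move=> j w; rewrite normrM ler_pM.
  - move=> w; apply: cvgM; last exact: cvg_cst.
    exact: (cvg_comp _ _ (cU w) (cg _)).
have cvSj j : \int[P]_w (g (Sj n j w) * V w) @[n --> \oo] -->
    \int[P']_w (g (Uj j w) * V (proj w)).
  by have /stable_cvgP := sS j; apply.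
apply/cvgrPdist_le => eps eps0.
(* The final error is one [del] for the limits in [j], one for the limit in [n], and
   [del * D + 2 * C * D * (4 * del)] for replacing [S n] by [Sj n j]. *)
pose del := eps / (2 + D + 8 * C * D).
have den0 : 0 < 2 + D + 8 * C * D.
  have CD := mulr_gt0 C0 D0; lra.
have del0 : 0 < del by rewrite divr_gt0.
have [k kP] := eventually_small_norm_gt P' mU del0; pose a : R := k%:R.
have U'e := Rintegral_ramp_le mU kP.
(* The level is [a + 1] because passing back from ramp integrals to tails raises it by 1. *)
have [eta eta0 etaP] := continuous_segment_modulus (a + 1) cg del0.
have m0 : 0 < Num.min eta del by rewrite lt_min eta0.
have /cvgrPdist_le /(_ _ del0) near1 := cvUj.
have near2 : \forall j \near \oo,
    `|\int[P']_w ramp a (U w) - \int[P']_w ramp a (Uj j w)| <= del.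
  suff /cvgrPdist_le : \int[P']_w ramp a (Uj j w) @[j --> \oo] -->
      \int[P']_w ramp a (U w) by apply.
  apply: (@Rintegral_bounded_cvg _ _ _ _ _ _ 1).
  - by move=> j; exact: measurable_ramp.
  - by move=> j w; have /andP[h0 h1] := ramp_ge0_le1 a (Uj j w); rewrite ger0_norm.
  - by move=> w; apply: (cvg_comp _ _ (cU w)); exact: continuous_ramp.
have [j [j1 j2 j3]] : exists j, [/\
    `|\int[P']_w (g (U w) * V (proj w)) - \int[P']_w (g (Uj j w) * V (proj w))| <= del,
    `|\int[P']_w ramp a (U w) - \int[P']_w ramp a (Uj j w)| <= del &
    \forall n \near \oo,
     small_event P [set w | Num.min eta del < `|S n w - Sj n j w|] (Num.min eta del)].
  have [j _ H] := filterI near1 (filterI near2 (close _ m0)).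
  by have [h1 [h2 h3]] := H j (leqnn j); exists j.
have /cvgrPdist_le /(_ _ del0) near3 := cvSj j.
have /cvgrPdist_le /(_ _ del0) near4 :=
  @stable_cvg_ramp _ _ _ _ _ _ _ _ _ _ _ _ a (sS j) cid.
near=> n.
have n3 : `|\int[P']_w (g (Uj j w) * V (proj w)) - \int[P]_w (g (Sj n j w) * V w)| <= del.
  by near: n.
have n4 : `|\int[P']_w ramp a (Uj j w) - \int[P]_w ramp a (Sj n j w)| <= del.
  by near: n.
have n5 : small_event P [set w | Num.min eta del < `|S n w - Sj n j w|] (Num.min eta del).
  by near: n.
(* One [del] is the tail of [U], one the passage from [U] to [Uj j], one the passage from [Uj j] to
   [Sj n j]. *)
have tight : small_event P [set w | a + 1 < `|Sj n j w|] (3 * del).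
  apply: (small_event_ramp (mSj n j)); move: U'e j2 n4; rewrite !ler_norml.
  by move=> ? /andP[? ?] /andP[? ?]; lra.
have mgS : measurable_fun setT (fun w => g (S n w) * V w) by exact: measurable_test.
have mgSj : measurable_fun setT (fun w => g (Sj n j w) * V w).
  exact: measurable_test.
have diff : `|\int[P]_w (g (Sj n j w) * V w - g (S n w) * V w)| <=
    del * D + 2 * C * D * (3 * del + del).
  have n5' := small_event_le (@subset_refl _ _) (_ : _ <= del) n5.
  have := small_eventU tight (n5' _); rewrite ge_min lexx orbT => /(_ isT).
  apply: normr_Rintegral_le_small.
  - exact: measurable_funB.
  - by rewrite mulr_ge0// ltW.
  - move=> w; rewrite -mulrBl normrM ler_pM//.
    by apply: le_trans (ler_normB _ _) _; have := gC (S n w); have := gC (Sj n j w); lra.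
  - move=> w /= /not_orP[/negP]; rewrite -leNgt => Sa /negP; rewrite -leNgt => SS.
    rewrite -mulrBl normrM ler_pM//; apply: etaP => //.
    by rewrite distrC (le_trans SS)// ge_min lexx.
rewrite RintegralB// in diff; last 2 first.
- by apply: (@bounded_integrable _ _ _ _ _ (C * D)) => // w; rewrite normrM ler_pM.
- by apply: (@bounded_integrable _ _ _ _ _ (C * D)) => // w; rewrite normrM ler_pM.
apply: le_trans (_ : del * (2 + D + 8 * C * D) <= _).
  move: j1 n3 diff; rewrite !ler_norml.
  move=> /andP[? ?] /andP[? ?] /andP[? ?]; apply/andP; split; lra.
by rewrite /del mulfVK// gt_eqF.
Unshelve. all: by end_near. Qed.

End stable_convergence_operations.

(** * Random points and local properties; gluing limits in probability *)

Section local_cover.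
Context (R : realType) (X : completeMetricType R) (x_ : nat -> X).
Hypothesis dense_x : dense (range x_).
Context d (T : measurableType d) (P : probability T R).

(** A Lindelöf argument: countably many balls with property [Q], centred at the dense points, cover
    [X]. Their finite unions still have [Q] and increase to [X], so [Y] lies in one of them with
    probability at least [1 - e]. *)
Lemma small_event_notin_local (Q : set X -> Prop) (Y : T -> X) (e : R) :
  Q set0 -> (forall U V, Q U -> Q V -> Q (U `|` V)) ->
  (forall U V, U `<=` V -> Q V -> Q U) ->
  (forall x, exists U, [/\ open U, U x & Q U]) ->
  borel_measurable Y -> 0 < e ->
  exists O, [/\ open O, Q O & small_event P [set w | ~ O (Y w)] e].
Proof.
move=> Q0 QU Qsub Qloc mY e0.
(* A ball without [Q] is replaced by the empty set, so that the family is indexed by all pairs [i],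
   [r]. *)
pose G i r : set X := let B := (ball (x_ i) (r.+1%:R^-1 : R))^° in
  if `[< Q B >] then B else set0.
have oG i r : open (G i r).
  by rewrite /G; case: ifP => _; [exact: open_interior|exact: open0].
have QG i r : Q (G i r) by rewrite /G; case: asboolP.
pose O n := \bigcup_(i in `I_n) \bigcup_(r in `I_n) G i r.
have oO n : open (O n) by apply: bigcup_open => i _; exact: bigcup_open.
have QO n : Q (O n).
  rewrite /O bigcup_mkord; apply: big_ind => // i _.
  by rewrite bigcup_mkord; apply: big_ind.
have mO n : measurable [set w | ~ O n (Y w)].
  rewrite [X in measurable X](_ : _ = ~` (Y @^-1` O n)) //; apply: measurableC.
  rewrite -[X in measurable X]setTI.
  by apply: (mY measurableT); exact: sub_sigma_algebra.
have [n _ nP] : \forall n \near \oo, small_event P [set w | ~ O n (Y w)] e.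
  apply: eventually_small_event => // w; set y := Y w.
  have [U [oU Uy QU']] := Qloc y.
  have /nbhs_ballP[r0 /= r00 r0U] : nbhs y U by exact: open_nbhs_nbhs.
  have r020 : 0 < r0 / 2 by rewrite divr_gt0.
  have [r rP] : exists r : nat, (r.+1%:R^-1 : R) < r0 / 2.
    have /ltr_add_invr[r] := r020.
    by rewrite add0r => ?; exists r.
  have del0 : 0 < (r.+1%:R^-1 : R) by rewrite invr_gt0.
  have del20 : 0 < (r.+1%:R^-1 : R) / 2 by rewrite divr_gt0.
  (* A centre within half the radius of [y] puts [y] in the interior of the ball, and keeps the ball
     within three halves of its radius around [y], hence inside [ball y r0]. *)
  have [||i yi] := dense_seq_open dense_x (U := (ball y (r.+1%:R^-1 / 2 : R))^°).
  - exact: open_interior.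
  - by exists y; exact: nbhsx_ballx.
  have {}yi := interior_subset yi.
  have Giry : G i r y.
    rewrite /G; case: asboolP => [_|[]].
      apply: (filterS _ (nbhsx_ballx y _ del20)) => z yz.
      rewrite [r.+1%:R^-1]splitr; apply: ball_triangle yz; exact: ball_sym.
    apply: Qsub QU' => z /interior_subset xz; apply: r0U.
    apply: (@le_ball _ _ _ (r.+1%:R^-1 / 2 + r.+1%:R^-1)).
      by move: rP del0; set del : R := r.+1%:R^-1; lra.
    exact: ball_triangle yi xz.
  exists (maxn i r).+1 => // n /= irn; apply => //; exists i => /=.
    by apply: leq_ltn_trans irn; exact: leq_maxl.
  by exists r => //=; apply: leq_ltn_trans irn; exact: leq_maxr.
by exists (O n); split => //; exact: nP (leqnn n).
Qed.

Lemma cvg_in_prob_glue (u : nat -> nat -> T -> R) (l : nat -> T -> R)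
    (i_ : T -> nat) m :
  (forall i n, measurable_fun setT (u i n)) ->
  (forall i, measurable_fun setT (l i)) -> measurable_fun setT i_ ->
  (forall w, (i_ w < m)%N) ->
  (forall i, cvg_in_prob P (u i) (l i)) ->
  cvg_in_prob P (fun n w => u (i_ w) n w) (fun w => l (i_ w) w).
Proof.
move=> mu ml mi im cul; apply/cvg_in_prob_small.
- by move=> n; exact: (measurable_glue (fun i => mu i n) mi im).
- exact: (measurable_glue ml mi im).
move=> e e0.
have m0 : (0 < m)%N by exact: leq_ltn_trans (im point).
have em0 : 0 < e / m%:R by rewrite divr_gt0// ltr0n.
have : \forall n \near \oo, forall i : 'I_m,
    small_event P [set w | e / m%:R < `|u i n w - l i w|] (e / m%:R).
  apply: filter_forall => i.
  by have /cvg_in_prob_small := cul i; apply.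
apply: filterS => n small.
have := @small_event_bigcup _ _ _ P
  (fun i => [set w | e / m%:R < `|u i n w - l i w|]) e m.
move=> /(_ (fun i im' => small (Ordinal im')) (ltW e0)).
apply: small_event_le => // w /= ew; exists (i_ w) => //=.
apply: le_lt_trans ew; rewrite ler_pdivrMr ?ltr0n// ler_peMr ?ler1n//.
exact: ltW.
Qed.

End local_cover.

(** * The random series at fixed and at random points *)

Section random_series.
Context (R : realType) d (A : measurableType d) (P : probability A R)
  (X : completeMetricType R) (Z : nat -> nat -> {RV P >-> R})
  (f : nat -> X -> R) (K : nat -> nat).
Hypothesis f_continuous : forall k, continuous (f k).

Lemma measurable_Zsum n M (Y : A -> X) :
  borel_measurable Y -> measurable_fun setT (Zsum K (Z n) f M Y).
Proof.
move=> mY; apply: measurable_sum => k; apply: measurable_funM => //.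
exact: measurable_continuous_comp mY (@f_continuous k).
Qed.

(** The bound is uniform in [n], and [x] is quantified inside the event, so that a random point of
    [U] may be substituted for it. The three lemmas that follow are the closure properties required
    by [small_event_notin_local]. *)
Definition locally_cauchy (U : set X) : Prop :=
  forall e : R, 0 < e -> exists M0, forall n M M', (M0 <= M)%N -> (M0 <= M')%N ->
    small_event P [set w | exists2 x, U x &
      e < `|Zsum K (Z n) f M (cst x) w - Zsum K (Z n) f M' (cst x) w|] e.

Lemma locally_cauchy0 : locally_cauchy set0.
Proof.
move=> e e0; exists 0%N => n M M' _ _.
by apply: small_event_le (small_event0 _ (ltW e0)) => // w [].
Qed.

Lemma locally_cauchy_subset U V : U `<=` V -> locally_cauchy V -> locally_cauchy U.
Proof.
move=> UV VP e e0; have [M0 H] := VP e e0; exists M0 => n M M' hM hM'.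
apply: small_event_le (H n M M' hM hM') => // w [x Ux ex].
by exists x => //; exact: UV.
Qed.

Lemma locally_cauchyU U V :
  locally_cauchy U -> locally_cauchy V -> locally_cauchy (U `|` V).
Proof.
move=> UP VP e e0; have e20 : 0 < e / 2 by rewrite divr_gt0.
have [M1 H1] := UP _ e20; have [M2 H2] := VP _ e20.
exists (maxn M1 M2) => n M M'; rewrite !geq_max.
move=> /andP[hM1 hM2] /andP[hM1' hM2'].
have := small_eventU (H1 n M M' hM1 hM1') (H2 n M M' hM2 hM2').
apply: small_event_le; last by rewrite -splitr.
by move=> w [x [Ux|Vx] ex]; [left|right]; exists x => //; lra.
Qed.

(** Compare both terms with a sum at a level beyond [M] that is already close to [L]. The discarded
    events are [Y] outside [U], of size [p], and one event of size [q] for each of the two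
    comparisons. *)
Lemma cauchy_dist_limit (U : set X) (Y : A -> X) (L : A -> R) n M (p q : R) :
  borel_measurable Y -> measurable_fun setT L -> 0 < q ->
  cvg_in_prob P (fun M => Zsum K (Z n) f M Y) L ->
  small_event P [set w | ~ U (Y w)] p ->
  (forall M', (M <= M')%N -> small_event P [set w | exists2 x, U x &
      q < `|Zsum K (Z n) f M' (cst x) w - Zsum K (Z n) f M (cst x) w|] q) ->
  small_event P [set w | 2 * q < `|L w - Zsum K (Z n) f M Y w|] (p + 2 * q).
Proof.
move=> mY mL q0 cL pU HM.
have /cvg_in_prob_small := cL.
move=> /(_ (fun M => measurable_Zsum n M mY) mL q q0)[M1 _ M1P].
have h1 := M1P (maxn M M1) (leq_maxr _ _).
have h2 := HM (maxn M M1) (leq_maxl _ _).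
have := small_eventU pU (small_eventU h2 h1).
apply: small_event_le; last lra.
move=> w /= qw; apply: contrapT => /not_orP[/contrapT UY] /not_orP[nU /negP].
rewrite -leNgt => nL; apply: nU; exists (Y w) => //.
rewrite ltNge; apply/negP => nU.
move: qw; rewrite ltNge => /negP; apply.
apply: le_trans (ler_distD (Zsum K (Z n) f (maxn M M1) Y w) _ _) _.
rewrite distrC; have := lerD nL nU; rewrite /Zsum/= => h; lra.
Qed.

Context (x_ : nat -> X).
Hypothesis dense_x : dense (range x_).
Hypothesis locally_cauchyP : forall x, exists U, [/\ open U, U x & locally_cauchy U].

(** While [Y] stays in an open locally Cauchy set, the deviation at [Y] is controlled by the uniform
    one; the event of leaving that set is made small. Constant [Y] covers the fixed points. *)
Lemma Zsum_cvg_in_prob n (Y : A -> X) : borel_measurable Y ->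
  exists W : {RV P >-> R}, cvg_in_prob P (fun M => Zsum K (Z n) f M Y) W.
Proof.
move=> mY; apply: cauchy_in_prob_cvg => [M|e e0]; first exact: measurable_Zsum.
have e20 : 0 < e / 2 by rewrite divr_gt0.
have [W [oW /(_ _ e20)[M0 OP] smallO]] := small_event_notin_local dense_x P
  locally_cauchy0 locally_cauchyU locally_cauchy_subset locally_cauchyP mY e20.
exists M0 => M M' hM hM'.
apply: small_event_le (small_eventU smallO (OP n M M' hM hM')); last first.
  by rewrite -splitr.
move=> w /= ew; have [Ow|] := pselect (W (Y w)); last by left.
by right; exists (Y w) => //; apply: lt_trans ew; lra.
Qed.

Hypothesis Z_tight : forall k (e : R), 0 < e -> exists2 a, 0 < a &
  \forall n \near \oo, small_event P [set w | a < `|Z n k w|] e.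

(** Tightness bounds the finitely many coefficients by constants [a k] for all large [n], and
    continuity of [f k] then makes the difference small. *)
Lemma Zsum_nearest_close M (Y : A -> X) (q : R) : borel_measurable Y -> 0 < q ->
  \forall j \near \oo, \forall n \near \oo,
    small_event P [set w | q < `|Zsum K (Z n) f M Y w -
      Zsum K (Z n) f M (fun w => x_ (nearest x_ j (Y w))) w|] (2 * q).
Proof.
move=> mY q0; set N := K M.
have [N0|N0] := posnP N.
  near=> j; near=> n; apply: small_event_le (small_event0 P _) => //; last first.
    by rewrite mulr_ge0// ltW.
  by move=> w /=; rewrite /Zsum -/N N0 !big_geq// subrr normr0 ltNge ltW.
have qN0 : 0 < q / N%:R by rewrite divr_gt0// ltr0n.
have /choice[a aP] (k : nat) : exists a, 0 < a /\
    \forall n \near \oo, small_event P [set w | a < `|Z n k w|] (q / N%:R).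
  by have [a a0 aP] := Z_tight k qN0; exists a.
have tight : \forall n \near \oo,
    small_event P [set w | exists2 k, (k < N)%N & a k < `|Z n k w|] q.
  have : \forall n \near \oo, forall k : 'I_N,
      small_event P [set w | a k < `|Z n k w|] (q / N%:R).
    by apply: filter_forall => k; have [] := aP k.
  apply: filterS => n small.
  exact: (@small_event_bigcup _ _ _ P (fun k => [set w | a k < `|Z n k w|]) _ _
    (fun k kN => small (Ordinal kN)) (ltW q0)).
(* This bound does not involve [n], so [j] can be chosen before [n]. *)
pose F j w := \sum_(0 <= k < N) a k * `|f k (Y w) - f k (x_ (nearest x_ j (Y w)))|.
have mfY k : measurable_fun setT (fun w => f k (Y w)).
  exact: measurable_continuous_comp mY (@f_continuous k).
have mF j : measurable_fun setT (F j).
  apply: measurable_sum => k; apply: measurable_funM => //.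
  apply: measurableT_comp => //; apply: measurable_funB => //.
  apply: (@measurable_glue _ _ _ (fun i _ => f k (x_ i)) _ j.+1).
  - by move=> i; exact: measurable_cst.
  - exact: measurable_nearest.
  - by move=> w; rewrite ltnS nearest_leq.
have F0 w : F j w @[j --> \oo] --> 0.
  have -> : 0 = \sum_(0 <= k < N) a k * `|f k (Y w) - f k (Y w)|.
    by rewrite big1// => k _; rewrite subrr normr0 mulr0.
  apply: cvg_big => [|k _]; first exact: add_continuous.
  apply: cvgM; first exact: cvg_cst.
  apply: cvg_norm; apply: cvgB; first exact: cvg_cst.
  by apply: continuous_cvg; [exact: f_continuous|exact: nearest_cvg].
have Fsmall : \forall j \near \oo, small_event P [set w | q < `|F j w|] q.
  apply: eventually_small_event => // [j|w]; first exact: measurable_norm_gt.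
  have /cvgrPdist_lt /(_ _ q0) := F0 w; apply: filterS => j.
  by rewrite sub0r normrN => h /=; apply/negP; rewrite -leNgt ltW.
near=> j; near=> n.
have hF : small_event P [set w | q < `|F j w|] q by near: j.
have hZ : small_event P [set w | exists2 k, (k < N)%N & a k < `|Z n k w|] q.
  by near: n.
apply: small_event_le (small_eventU hF hZ); last lra.
move=> w /= qw; apply: contrapT => /not_orP[/negP]; rewrite -leNgt => Fq nZ.
move: qw; rewrite ltNge => /negP; apply; apply: le_trans Fq.
apply: le_trans (ler_norm _); rewrite /Zsum -/N -sumrB.
apply: le_trans (ler_norm_sum _ _ _) _.
rewrite /F big_nat [leRHS]big_nat; apply: ler_sum => k /andP[_ kN].
rewrite -mulrBr normrM ler_wpM2r// leNgt; apply/negP => ak.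
by apply: nZ; exists k.
Unshelve. all: by end_near. Qed.

(** The path goes from the limit at [Y] to its sum at level [M], then to the sum at the nearest
    point, then to the limit there. The level [M] serves all [n] at once. *)
Lemma limit_nearest_close (Y : A -> X) (LY : nat -> {RV P >-> R})
    (L : nat -> X -> {RV P >-> R}) : borel_measurable Y ->
  (forall n, cvg_in_prob P (fun M => Zsum K (Z n) f M Y) (LY n)) ->
  (forall n x, cvg_in_prob P (fun M => Zsum K (Z n) f M (cst x)) (L n x)) ->
  forall e, 0 < e -> \forall j \near \oo, \forall n \near \oo,
    small_event P [set w | e < `|LY n w - L n (x_ (nearest x_ j (Y w))) w|] e.
Proof.
(* The exceptional events have sizes [3 * q], [2 * q] and [4 * q]; the deviations only add up to
   [5 * q]. *)
move=> mY cLY cL e e0; pose q := e / 9.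
have q0 : 0 < q by rewrite divr_gt0.
have [G [oG /(_ _ q0)[M OP] smallO]] := small_event_notin_local dense_x P
  locally_cauchy0 locally_cauchyU locally_cauchy_subset locally_cauchyP mY q0.
pose Yj j w := x_ (nearest x_ j (Y w)).
have mnear j := measurable_nearest x_ j mY.
have mYj j : borel_measurable (Yj j).
  move=> _ B mB; rewrite setTI.
  rewrite (_ : _ @^-1` B = (fun w => nearest x_ j (Y w)) @^-1` [set i | B (x_ i)])//.
  by rewrite -[X in measurable X]setTI; exact: mnear.
have mO (W : A -> X) : borel_measurable W -> measurable [set w | G (W w)].
  move=> mW; rewrite -[X in measurable X]setTI.
  by apply: (mW measurableT); exact: sub_sigma_algebra.
(* Since [G] is open and the nearest points converge to [Y w], they eventually enter [G] whenever
   [Y w] is in it. *)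
have nearO : \forall j \near \oo,
    small_event P [set w | G (Y w) /\ ~ G (Yj j w)] q.
  apply: eventually_small_event => // [j|w].
    by apply: measurableI; [exact: mO|apply: measurableC; exact: mO].
  have [OY|nOY] := pselect (G (Y w)); last by apply: nearW => j [].
  have nG : nbhs (Y w) G by exact: open_nbhs_nbhs.
  have : \forall j \near \oo, G (x_ (nearest x_ j (Y w))) by exact: nearest_cvg nG.
  by apply: filterS => j /= Oj [_]; exact.
have nearS := Zsum_nearest_close M mY q0.
near=> j.
have hO : small_event P [set w | G (Y w) /\ ~ G (Yj j w)] q by near: j.
have hS : \forall n \near \oo, small_event P [set w | q < `|Zsum K (Z n) f M Y w -
      Zsum K (Z n) f M (Yj j) w|] (2 * q) by near: j.
apply: filterS hS => n hS.
have hOj : small_event P [set w | ~ G (Yj j w)] (q + q).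
  apply: small_event_le (small_eventU smallO hO) => // w /= nOj.
  by have [OY|nOY] := pselect (G (Y w)); [right|left].
have OPn M' : (M <= M')%N -> small_event P [set w | exists2 x, G x &
    q < `|Zsum K (Z n) f M' (cst x) w - Zsum K (Z n) f M (cst x) w|] q.
  by move=> MM'; exact: OP.
(* The approximation takes finitely many values, so the limit of the series along it is glued from
   the limits at fixed points. *)
have cLj : cvg_in_prob P (fun M => Zsum K (Z n) f M (Yj j)) (fun w => L n (Yj j w) w).
  apply: (@cvg_in_prob_glue _ _ _ P (fun i M => Zsum K (Z n) f M (cst (x_ i)))
    (fun i => L n (x_ i)) _ j.+1) => //.
  - by move=> i M'; apply: measurable_Zsum; exact: measurable_cst.
  - by move=> w; rewrite ltnS nearest_leq.
have mLj : measurable_fun setT (fun w => L n (Yj j w) w).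
  apply: (@measurable_glue _ _ _ (fun i => L n (x_ i)) _ j.+1) => //.
  by move=> w; rewrite ltnS nearest_leq.
have h1 := cauchy_dist_limit mY (measurable_funPT (LY n)) q0 (cLY n) smallO OPn.
have h2 := cauchy_dist_limit (mYj j) mLj q0 cLj hOj OPn.
have := small_eventU h1 (small_eventU hS h2).
apply: small_event_le; last by rewrite /q; lra.
move=> w /= ew; apply: contrapT => /not_orP[/negP]; rewrite -leNgt => k1.
move=> /not_orP[/negP + /negP]; rewrite -!leNgt => k2 k3.
move: ew; rewrite ltNge => /negP; apply.
apply: le_trans (ler_distD (Zsum K (Z n) f M Y w) _ _) _.
apply: le_trans (lerD k1 (ler_distD (Zsum K (Z n) f M (Yj j) w) _ _)) _.
rewrite (distrC _ (L n _ w)); have := lerD k2 k3; rewrite /q => k4; lra.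
Unshelve. all: by end_near. Qed.

End random_series.

(** * From the tail bounds of the second assumption to the local Cauchy property *)

Lemma locally_cauchy_tail (R : realType) d (A : measurableType d)
    (P : probability A R) (X : completeMetricType R) (x_ : nat -> X)
    (Z V : nat -> nat -> {RV P >-> R}) (f : nat -> X -> R) (K : nat -> nat)
    (U : set X) :
  dense (range x_) -> (forall k, continuous (f k)) ->
  (forall m m', (m <= m')%N -> (K m <= K m')%N) -> open U ->
  (forall eps delta : R, 0 < eps -> 0 < delta ->
     exists2 M : nat, (0 < M)%N &
     forall M' n : nat, (M < M')%N ->
       (P [set w | (delta%:E < ereal_sup
          [set (`|(\sum_(K M <= k < K M') Z n k w * f k x')%R| +
                `|(Vsum K V f M' x' w - Vsum K V f M x' w)%R|)%:E
            | x' in U])%E] < eps%:E)%E) ->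
  locally_cauchy Z f K U.
Proof.
move=> dense_x cf Kincr oU tail e e0.
have e20 : 0 < e / 2 by rewrite divr_gt0.
have [M _ MP] := tail _ _ e20 e20.
have csum m n (g : nat -> X -> R) : (forall k, continuous (g k)) ->
    continuous (fun x => \sum_(m <= k < n) g k x).
  by move=> cg x; apply: cvg_big => [|k _]; [exact: add_continuous|exact: cg].
pose h n M' w x : R := `|\sum_(K M <= k < K M') Z n k w * f k x| +
  `|Vsum K V f M' x w - Vsum K V f M x w|.
have mVsum M' x : measurable_fun setT (Vsum K V f M' x).
  apply: measurable_sum => k; apply: measurable_sum => k'.
  by apply: measurable_funM => //; apply: measurable_funM.
have cVsum M' w : continuous (Vsum K V f M' ^~ w).
  apply: (csum _ _) => k; apply: (csum _ _) => k' x.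
  apply: cvgM; last exact: cf.
  by apply: cvgM; [exact: cvg_cst|exact: cf].
have mh n M' x : measurable_fun setT (h n M' ^~ x).
  apply: measurable_funD; apply: measurableT_comp => //.
    by apply: measurable_sum => k; apply: measurable_funM.
  exact: measurable_funB.
have ch n M' w : continuous (h n M' w).
  move=> x; apply: cvgD; apply: cvg_norm.
    by apply: (csum _ _) => k y; apply: cvgM; [exact: cvg_cst|exact: cf].
  by apply: cvgB; exact: cVsum.
pose B n M' := [set w | exists2 x, U x & e / 2 < h n M' w x].
have smallB n M' : (M < M')%N -> small_event P (B n M') (e / 2).
  (* The supremum over [U] exceeds the threshold exactly when some point of [U] does; continuity of
     [h n M' w] makes that event measurable. *)
  move=> MM'; apply: measurable_small_event.
    exact: (measurable_exists_gt dense_x).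
  apply: ltW; apply: le_lt_trans (MP M' n MM').
  rewrite le_eqVlt; apply/orP; left; apply/eqP; congr (P _).
  apply/seteqP; split => w /=.
    move=> [x Ux hx]; apply/ereal_sup_gtP; exists (h n M' w x)%:E; first by exists x.
    by rewrite lte_fin.
  by move=> /ereal_sup_gtP[_ [x Ux <-]]; rewrite lte_fin; exists x.
have ZB n M' x w : (M < M')%N ->
    `|Zsum K (Z n) f M' (cst x) w - Zsum K (Z n) f M (cst x) w| <= h n M' w x.
  move=> MM'; rewrite /Zsum (big_cat_nat (leq0n _) (Kincr _ _ (ltnW MM')))/=.
  by rewrite addrAC subrr add0r lerDl.
(* The tail bound compares [M] with strictly larger levels only; [M1] and [M2] are compared through
   [M], at half the budget each. *)
exists M.+1 => n M1 M2 h1 h2.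
apply: small_event_le (small_eventU (smallB n M1 h1) (smallB n M2 h2)); last first.
  by rewrite -splitr.
move=> w [x Ux ex]; apply: contrapT => /not_orP[n1 n2].
have k1 : h n M1 w x <= e / 2 by rewrite leNgt; apply/negP => ?; apply: n1; exists x.
have k2 : h n M2 w x <= e / 2 by rewrite leNgt; apply/negP => ?; apply: n2; exists x.
move: ex; rewrite ltNge => /negP; apply.
apply: le_trans (ler_distD (Zsum K (Z n) f M (cst x) w) _ _) _.
rewrite [X in _ + X]distrC.
have := lerD (le_trans (ZB n M1 x w h1) k1) (le_trans (ZB n M2 x w h2) k2); lra.
Qed.

(** * Existence of the limits and stable convergence at a random point *)

Theorem proposition3p2
  (R : realType)
  (d : measure_display) (A : measurableType d) (P : probability A R)
  (X : completeMetricType R) (X_separable : separable X)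
  (Z : nat -> nat -> {RV P >-> R}) (V : nat -> nat -> {RV P >-> R})
  (f : nat -> X -> R) (f_continuous : forall k, continuous (f k))
  (K : nat -> nat) (K0 : K 0%N = 0%N)
  (K_gt0 : forall m, (0 < m)%N -> (0 < K m)%N)
  (K_incr : forall m m', (m <= m')%N -> (K m <= K m')%N)
  (K_infty : K @ \oo --> \oo)
  (hyp1 : forall m, (0 < m)%N ->
    {ae P, forall w, symmetric_nonneg (Vmx K V m w)} /\
    exists (d' : measure_display) (A' : measurableType d')
      (P' : probability A' R) (proj : {RV P' >-> A}) (N : A' -> 'cV[R]_(K m)),
      [/\ is_extension P proj, standard_normal P' N, independent_of_base proj N &
          stable_cvg P proj (fun n => Zvec K (Z n) m)
            (fun w => sqrtmx (Vmx K V m (proj w)) *m N w)])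
  (hyp2 : forall x : X, exists U : set X,
    [/\ open U, U x &
     forall eps delta : R, 0 < eps -> 0 < delta ->
     exists2 M : nat, (0 < M)%N &
     forall M' n : nat, (M < M')%N ->
       (P [set w | (delta%:E < ereal_sup
          [set (`|(\sum_(K M <= k < K M') Z n k w * f k x')%R| +
                `|(Vsum K V f M' x' w - Vsum K V f M x' w)%R|)%:E
            | x' in U])%E] < eps%:E)%E]) :
  (forall (n : nat) (x : X), exists W : {RV P >-> R},
     cvg_in_prob P (fun M => Zsum K (Z n) f M (cst x)) W) /\
  (forall (Zlim : nat -> X -> {RV P >-> R}),
     (forall n x,
        cvg_in_prob P (fun M => Zsum K (Z n) f M (cst x)) (Zlim n x)) ->
   forall (d' : measure_display) (A' : measurableType d')
     (P' : probability A' R) (proj : {RV P' >-> A}),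
     is_extension P proj ->
   forall (Zfield : X -> {RV P' >-> R}),
     (forall w, continuous (fun x => Zfield x w)) ->
     (forall x, stable_cvg P proj (fun n => Zlim n x) (Zfield x)) ->
   forall Y : {RV P >-> borel X},
     (forall n, exists W : {RV P >-> R},
        cvg_in_prob P (fun M => Zsum K (Z n) f M Y) W) /\
     (forall ZlimY : nat -> {RV P >-> R},
        (forall n, cvg_in_prob P (fun M => Zsum K (Z n) f M Y) (ZlimY n)) ->
        stable_cvg P proj ZlimY (fun w => Zfield (Y (proj w)) w))).
Proof.
have [x_ dense_x] := separable_seq X_separable.
have loc x : exists U, [/\ open U, U x & locally_cauchy Z f K U].
  have [U [oU Ux tail]] := hyp2 x; exists U; split => //.
  exact: (locally_cauchy_tail dense_x f_continuous K_incr oU tail).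
split=> [n x|Zlim cZlim d' A' P' proj _ Zfield cZfield sZfield Y].
  exact: (Zsum_cvg_in_prob f_continuous dense_x loc n (measurable_cst (x : borel X))).
have mY : borel_measurable (Y : A -> X) by exact: measurable_funPT.
split=> [n|ZlimY cZlimY].
  exact: (Zsum_cvg_in_prob f_continuous dense_x loc n mY).
(* [Z n k] is a coordinate of the stably convergent vector of any stage [m] with [k < K m]. Stage
   [m.+1] is taken below because the first assumption concerns positive stages. *)
have tight k (e : R) : 0 < e -> exists2 a, 0 < a &
    \forall n \near \oo, small_event P [set w | a < `|Z n k w|] e.
  move=> e0.
  have [m [m0 km]] : exists m, (0 < m)%N /\ (k < K m)%N.
    have [m _ mP] := K_infty _ (nbhs_infty_gt k).
    by exists m.+1; split => //; exact: (mP m.+1 (leqnSn m)).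
  have [_ [d1 [A1 [P1 [proj1 [N [_ _ _ sN]]]]]]] := hyp1 m m0.
  have cphi : continuous (fun v : 'cV[R]_(K m) => v (Ordinal km) 0).
    exact: coord_continuous.
  have [a a0 aP] := stable_cvg_tight sN cphi e0.
  by exists a => //; apply: filterS aP => n; under eq_set do rewrite mxE.
pose Yj j w := x_ (nearest x_ j (Y w)).
apply: (@stable_cvg_approx _ _ _ _ _ _ _ proj _
  (fun n j w => Zlim n (Yj j w) w) _ (fun j w => Zfield (Yj j (proj w)) w)).
- by move=> n; exact: measurable_funPT.
- move=> j; apply: (@stable_cvg_glue _ _ _ _ _ _ _ proj
    (fun n i => Zlim n (x_ i)) (fun i => Zfield (x_ i)) _ j.+1) => //.
  + exact: measurable_nearest.
  + by move=> w; rewrite ltnS nearest_leq.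
- move=> w; apply: (cvg_comp (fun j => Yj j (proj w)) (Zfield ^~ w)).
    exact: nearest_cvg.
  exact: cZfield.
- exact: (limit_nearest_close f_continuous dense_x loc tight mY cZlimY cZlim).
Qed.
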